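(* Let $(B,\cdot,\circ)$ be a completely simple left semi-brace such that $\rho:(B,\circ)\to\mathrm{Map}(B,B)$ is an anti-homomorphism. Then (1) $R=E(1_{\circ}B)$ is a right zero left semi-brace $(R,\cdot,\circ)$, (2) $K=B1_{\circ}$ is a right cancellative left semi-brace $(K,\cdot,\circ)$, (3) $(B,\cdot,\circ)\cong(K,\cdot,\circ)\bowtie(R,\cdot,\circ)$, a matched product of left semi-braces (for suitable $\delta$ and $\sigma$). Furthermore, as multiplicative semigroups, $B\cong\mathcal{M}(1_{\circ}B1_{\circ},|E(K)|,|E(R)|,\mathcal{I}_{|E(R)|,|E(K)|})$.
   Context: A left semi-brace is a set $B$ with two operations $\cdot$ and $\circ$ such that $(B,\cdot)$ is a semigroup, $(B,\circ)$ is a group, and $a\circ(bc)=(a\circ b)(a\circ(\overline{a}c))$ for all $a,b,c\in B$ (here $xy$ means $x\cdot y$ and $\overline{a}$ is the inverse of $a$ in $(B,\circ)$). The identity of $(B,\circ)$ is $1_{\circ}$. $1_{\circ}B=\{1_{\circ}b\mid b\in B\}$, $B1_{\circ}=\{b1_{\circ}\mid b\in B\}$, $1_{\circ}B1_{\circ}=\{1_{\circ}b1_{\circ}\mid b\in B\}$. $E(S)$ denotes the set of idempotents of $S$ with respect to $\cdot$. A left semi-brace is completely simple, right cancellative, or right zero if $(B,\cdot)$ is so (right zero: $xy=y$ for all $x,y$). The $\rho$-map: $\rho_a:B\to B$, $\rho_a(b)=\overline{(\overline{b}a)}\circ a$; $\rho:a\mapsto\rho_a$ is an anti-homomorphism if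 $\rho_{a\circ b}=\rho_b\rho_a$ (composition of maps) for all $a,b\in B$. Matched product: let $(A,\cdot,\circ)$ and $(S,\cdot,\circ)$ be left semi-braces, $\delta:A\to\mathrm{Sym}(S)$ a right action of the group $(A,\circ)$ on the set $S$ (so $\delta_a\delta_b=\delta_{b\circ a}$), and $\sigma:S\to\mathrm{Aut}(A,\cdot)$ a left action of the group $(S,\circ)$ (so $\sigma_x\sigma_y=\sigma_{x\circ y}$), such that for all $x,y\in S$, $a,b\in A$: (i) $\sigma_x(a\circ b)=\sigma_x(a)\circ\sigma_{\delta_a(x)}(b)$; (ii) $\sigma_x(1_{\circ})=1_{\circ}$; (iii) $\delta_a(x\circ y)=\delta_{\sigma_y(a)}(x)\circ\delta_a(y)$; (iv) $\delta_a(1_{\circ})=1_{\circ}$; (v) $\overline{\delta_a(\overline{xy})}=\overline{\delta_a(\overline{x})}\;\overline{\delta_a(\overline{y})}$. The matched product $A\bowtie S$ (by $\delta$ and $\sigma$) is the left semi-brace on $A\times S$ with $(a,x)(b,y)=(ab,xy)$ and $(a,x)\circ(b,y)=\left(a\circ\sigma_{\overline{\delta_a(\overline{x})}}(b),\ x\circ\overline{\delta_{\overline{\sigma_{\overline{x}}(a)}}(\overline{y})}\right)$. For a group $G$ and cardinals (or sets) $I,J$, $\mathcal{M}(G,I,J,\mathcal{I}_{|J|,|I|})$ is the semigroup of triples $(g,i,j)$ with $g\in G$, $i\in I$, $j\in J$ and product $(g,i,j)(h,k,l)=(gh,i,l)$ (sandwich matrix with all entries the identity of $G$). Isomorphisms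 of left semi-braces are bijections respecting both operations. *)

(* Defs.v *)
From HB Require Import structures.
From mathcomp Require Import all_boot.
From mathcomp Require Import boolp classical_sets.

Set Implicit Arguments.
Unset Strict Implicit.
Unset Printing Implicit Defensive.

Declare Scope semibrace_scope.
Delimit Scope semibrace_scope with SB.
Local Open Scope classical_set_scope.
Local Open Scope group_scope.
Local Open Scope semibrace_scope.

(* The canonical group structure of a left semi-brace is its circle group, so *)
(* [1] and [x^-1] are the identity and the inverse of (B, ∘).                 *)
Notation "x ∘ y" := (mul x y)
  (at level 40, left associativity) : semibrace_scope.

HB.mixin Record Group_isLeftSemiBrace B of Group B := {
  dot : B -> B -> B;
  dotA : associative dot;
  circ_dot : forall a b c : B,
    a ∘ dot b c = dot (a ∘ b) (a ∘ dot a^-1 c)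
}.

#[short(type="leftSemiBraceType")]
HB.structure Definition LeftSemiBrace :=
  { B of Group_isLeftSemiBrace B & Group B }.

Notation "x ⋅ y" := (dot x y)
  (at level 40, left associativity) : semibrace_scope.

Section Semigroups.
Variables (T : Type) (op : T -> T -> T).

Definition is_ideal (I : set T) : Prop :=
  I !=set0 /\ forall x y, I x -> I (op x y) /\ I (op y x).

Definition simple_semigroup : Prop :=
  forall I : set T, is_ideal I -> I = setT.

Definition primitive_idempotent (e : T) : Prop :=
  op e e = e /\
  forall f, op f f = f -> op e f = f -> op f e = f -> f = e.

Definition completely_simple : Prop :=
  simple_semigroup /\ exists e, primitive_idempotent e.

(* ssrfun's [left_injective] says that x z = y z implies x = y. *)
Definition right_cancellative_semigroup : Prop := left_injective op.

Definition right_zero_semigroup : Prop := forall x y, op x y = y.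

End Semigroups.

Definition semigroup_isomorphic (T U : Type)
    (opT : T -> T -> T) (opU : U -> U -> U) : Prop :=
  exists f : T -> U, bijective f /\ {morph f : x y / opT x y >-> opU x y}.

Definition semibrace_isomorphic (B C : leftSemiBraceType) : Prop :=
  exists f : B -> C, [/\ bijective f,
    {morph f : x y / x ⋅ y >-> x ⋅ y} & {morph f : x y / x ∘ y >-> x ∘ y}].

Definition completely_simple_semibrace (B : leftSemiBraceType) : Prop :=
  completely_simple (@dot B).

Definition right_cancellative_semibrace (B : leftSemiBraceType) : Prop :=
  right_cancellative_semigroup (@dot B).

Definition right_zero_semibrace (B : leftSemiBraceType) : Prop :=
  right_zero_semigroup (@dot B).

(* The sandwich matrix has all its entries equal to 1, hence g p_(j,k) h is   *)
(* just g h.                                                                  *)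
Definition rees_mul (G : groupType) (I J : Type) (s t : G * I * J) :
    G * I * J :=
  let: (g, i, _) := s in let: (h, _, l) := t in (mul g h, i, l).
Arguments rees_mul : clear implicits.

Section SubsetsOfSemiBrace.
Variable B : leftSemiBraceType.
Implicit Types (P : set B).

Definition one_dot : set B := [set 1 ⋅ b | b in [set: B]].

Definition dot_one : set B := [set b ⋅ 1 | b in [set: B]].

Definition one_dot_one : set B := [set 1 ⋅ b ⋅ 1 | b in [set: B]].

Definition idempotents P : set B := [set x | P x /\ x ⋅ x = x].

Definition rho (a b : B) : B := (b^-1 ⋅ a)^-1 ∘ a.

Definition rho_antihom : Prop :=
  forall a b : B, rho (a ∘ b) =1 rho b \o rho a.

Record sub_semibrace P : Prop := SubSemiBrace {
  sub_one : P 1;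
  sub_circ : forall x y, P x -> P y -> P (x ∘ y);
  sub_inv : forall x, P x -> P x^-1;
  sub_dot : forall x y, P x -> P y -> P (x ⋅ y)
}.

(* A group structure on P for the restriction of the dot operation; its       *)
(* identity and inverse are unrelated a priori to those of the circle group.  *)
Record dot_group P : Type := DotGroup {
  dg_one : B;
  dg_inv : B -> B;
  dg_dot_in : forall x y, P x -> P y -> P (x ⋅ y);
  dg_one_in : P dg_one;
  dg_inv_in : forall x, P x -> P (dg_inv x);
  dg_1mul : forall x, P x -> dg_one ⋅ x = x;
  dg_mul1 : forall x, P x -> x ⋅ dg_one = x;
  dg_Vmul : forall x, P x -> dg_inv x ⋅ x = dg_one;
  dg_mulV : forall x, P x -> x ⋅ dg_inv x = dg_one
}.

End SubsetsOfSemiBrace.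
Arguments one_dot : clear implicits.
Arguments dot_one : clear implicits.
Arguments one_dot_one : clear implicits.
Arguments rho_antihom : clear implicits.

Section SubSemiBraceStructure.
Variables (B : leftSemiBraceType) (P : set B) (HP : sub_semibrace P).

Definition sub_semibrace_type (_ : sub_semibrace P) : Type := set_type P.
Local Notation subB := (sub_semibrace_type HP).

HB.instance Definition _ := Choice.on subB.

Let inP (x : subB) : P (val x) := set_valP x.

Definition ssb_one : subB := SigSub (mem_set (sub_one HP)).
Definition ssb_inv (x : subB) : subB :=
  SigSub (mem_set (sub_inv HP (inP x))).
Definition ssb_circ (x y : subB) : subB :=
  SigSub (mem_set (sub_circ HP (inP x) (inP y))).
Definition ssb_dot (x y : subB) : subB :=
  SigSub (mem_set (sub_dot HP (inP x) (inP y))).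

Fact ssb_circA : associative ssb_circ.
Proof. by move=> x y z; apply: val_inj; rewrite /= mulgA. Qed.
Fact ssb_1circ : left_id ssb_one ssb_circ.
Proof. by move=> x; apply: val_inj; rewrite /= mul1g. Qed.
Fact ssb_circ1 : right_id ssb_one ssb_circ.
Proof. by move=> x; apply: val_inj; rewrite /= mulg1. Qed.
Fact ssb_Vcirc : left_inverse ssb_one ssb_inv ssb_circ.
Proof. by move=> x; apply: val_inj; rewrite /= mulVg. Qed.
Fact ssb_circV : right_inverse ssb_one ssb_inv ssb_circ.
Proof. by move=> x; apply: val_inj; rewrite /= mulgV. Qed.

HB.instance Definition _ := isGroup.Build subB
  ssb_circA ssb_1circ ssb_circ1 ssb_Vcirc ssb_circV.

Fact ssb_dotA : associative ssb_dot.
Proof. by move=> x y z; apply: val_inj; rewrite /= dotA. Qed.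
Fact ssb_circ_dot (a b c : subB) :
  a ∘ ssb_dot b c = ssb_dot (a ∘ b) (a ∘ ssb_dot a^-1 c).
Proof. by apply: val_inj; rewrite /= circ_dot. Qed.

HB.instance Definition _ :=
  Group_isLeftSemiBrace.Build subB ssb_dotA ssb_circ_dot.

End SubSemiBraceStructure.

Section DotGroupStructure.
Variables (B : leftSemiBraceType) (P : set B) (G : dot_group P).

Definition dot_group_type (_ : dot_group P) : Type := set_type P.
Local Notation gT := (dot_group_type G).

HB.instance Definition _ := Choice.on gT.

Let inP (x : gT) : P (val x) := set_valP x.

Definition dgt_one : gT := SigSub (mem_set (dg_one_in G)).
Definition dgt_inv (x : gT) : gT := SigSub (mem_set (dg_inv_in G (inP x))).
Definition dgt_mul (x y : gT) : gT :=
  SigSub (mem_set (dg_dot_in G (inP x) (inP y))).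

Fact dgt_mulA : associative dgt_mul.
Proof. by move=> x y z; apply: val_inj; rewrite /= dotA. Qed.
Fact dgt_1mul : left_id dgt_one dgt_mul.
Proof. by move=> x; apply: val_inj; rewrite /= (dg_1mul G (inP x)). Qed.
Fact dgt_mul1 : right_id dgt_one dgt_mul.
Proof. by move=> x; apply: val_inj; rewrite /= (dg_mul1 G (inP x)). Qed.
Fact dgt_Vmul : left_inverse dgt_one dgt_inv dgt_mul.
Proof. by move=> x; apply: val_inj; rewrite /= (dg_Vmul G (inP x)). Qed.
Fact dgt_mulV : right_inverse dgt_one dgt_inv dgt_mul.
Proof. by move=> x; apply: val_inj; rewrite /= (dg_mulV G (inP x)). Qed.

HB.instance Definition _ := isGroup.Build gT
  dgt_mulA dgt_1mul dgt_mul1 dgt_Vmul dgt_mulV.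

End DotGroupStructure.

Record matched_pair (A S : leftSemiBraceType) : Type := MatchedPair {
  delta : A -> S -> S;
  sigma : S -> A -> A;
  delta_bij : forall a, bijective (delta a);
  delta_act : forall a b, delta a \o delta b =1 delta (b ∘ a);
  sigma_bij : forall x, bijective (sigma x);
  sigma_dot : forall x, {morph sigma x : a b / a ⋅ b >-> a ⋅ b};
  sigma_act : forall x y, sigma x \o sigma y =1 sigma (x ∘ y);
  sigma_circ : forall x a b,
    sigma x (a ∘ b) = sigma x a ∘ sigma (delta a x) b;
  sigma_1 : forall x, sigma x 1 = 1;
  delta_circ : forall a x y,
    delta a (x ∘ y) = delta (sigma y a) x ∘ delta a y;
  delta_1 : forall a, delta a 1 = 1;
  delta_dot : forall a x y,
    (delta a (x ⋅ y)^-1)^-1 = (delta a x^-1)^-1 ⋅ (delta a y^-1)^-1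
}.

Section MatchedProduct.
Variables (A S : leftSemiBraceType) (M : matched_pair A S).

Definition matched_product (_ : matched_pair A S) : Type := (A * S)%type.
Local Notation AS := (matched_product M).
Local Notation δ := (delta M).
Local Notation σ := (sigma M).

HB.instance Definition _ := Choice.on AS.

Definition mp_dot (u v : AS) : AS := (u.1 ⋅ v.1, u.2 ⋅ v.2).

Definition mp_circ (u v : AS) : AS :=
  let: (a, x) := u in let: (b, y) := v in
  (a ∘ σ (δ a x^-1)^-1 b, x ∘ (δ (σ x^-1 a)^-1 y^-1)^-1).

(* In the Zappa-Szep product of the circle groups, (a, x) stands for the      *)
(* element a z = x c with z = (δ a x^-1)^-1 and c = σ x^-1 a, whose inverse   *)
(* z^-1 a^-1 = c^-1 x^-1 is represented by [mp_inv (a, x)].                   *)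
Definition mp_one : AS := (1, 1).

Definition mp_inv (u : AS) : AS :=
  let: (a, x) := u in (σ (δ a x^-1) a^-1, δ a x^-1).

Let zs (u v : A * S) : A * S := (u.1 ∘ σ u.2 v.1, δ v.1 u.2 ∘ v.2).
Let phi (u : AS) : A * S := (u.1, (δ u.1 u.2^-1)^-1).

Let deltaM a b x : δ a (δ b x) = δ (b ∘ a) x.
Proof. exact: (delta_act M a b x). Qed.
Let sigmaM x y a : σ x (σ y a) = σ (x ∘ y) a.
Proof. exact: (sigma_act M x y a). Qed.
Let delta_id x : δ 1 x = x.
Proof. by apply: (bij_inj (delta_bij M 1)); rewrite deltaM mulg1. Qed.
Let sigma_id a : σ 1 a = a.
Proof. by apply: (bij_inj (sigma_bij M 1)); rewrite sigmaM mulg1. Qed.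
Let deltaK a x : δ a (δ a^-1 x) = x.
Proof. by rewrite deltaM mulVg delta_id. Qed.
Let deltaVK a x : δ a^-1 (δ a x) = x.
Proof. by rewrite deltaM mulgV delta_id. Qed.
Let sigmaK x a : σ x (σ x^-1 a) = a.
Proof. by rewrite sigmaM mulgV sigma_id. Qed.
Let sigmaVK x a : σ x^-1 (σ x a) = a.
Proof. by rewrite sigmaM mulVg sigma_id. Qed.

Let deltaV a x : (δ a x)^-1 = δ (σ x a) x^-1.
Proof.
by apply: (@mulIg _ (δ a x)); rewrite mulVg -delta_circ mulVg delta_1.
Qed.

Let zsA : associative zs.
Proof.
move=> [a x] [b y] [c z]; congr (_, _) => /=.
  by rewrite sigma_circ -sigmaM mulgA.
by rewrite delta_circ deltaM mulgA.
Qed.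

Let phi_inj : injective phi.
Proof.
move=> [a x] [b y] [<-] /invg_inj /(bij_inj (delta_bij M a)) /invg_inj -> //.
Qed.

Let phiM u v : phi (mp_circ u v) = zs (phi u) (phi v).
Proof.
case: u v => [a x] [b y]; congr (_, _) => /=.
rewrite !invgM invgK -deltaM delta_circ deltaK delta_circ.
by rewrite sigmaK invgM [in LHS](deltaV _ (δ a _)) sigmaK.
Qed.

Fact mp_circA : associative mp_circ.
Proof. by move=> u v w; apply: phi_inj; rewrite !phiM zsA. Qed.
Fact mp_1circ : left_id mp_one mp_circ.
Proof.
by case=> a x; rewrite /mp_circ /= invg1 delta_1 !invg1 sigma_id sigma_1 invg1
  delta_id invgK !mul1g.
Qed.
Fact mp_circ1 : right_id mp_one mp_circ.
Proof.
by case=> a x; rewrite /mp_circ /= invg1 delta_1 sigma_1 invg1 !mulg1.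
Qed.

Let phi_inv a x :
  phi (mp_inv (a, x)) = (σ (δ a x^-1) a^-1, x^-1).
Proof. by rewrite /phi /= -deltaV invgK deltaVK. Qed.

Let phi_one : phi mp_one = (1, 1).
Proof. by rewrite /phi /= delta_id !invg1. Qed.

Fact mp_Vcirc : left_inverse mp_one mp_inv mp_circ.
Proof.
case=> a x; apply: phi_inj; rewrite phiM phi_inv phi_one /zs /= mulgV.
by rewrite -{2}(deltaVK a x^-1) -sigma_circ mulVg sigma_1.
Qed.
Fact mp_circV : right_inverse mp_one mp_inv mp_circ.
Proof.
case=> a x; apply: phi_inj; rewrite phiM phi_inv phi_one /zs /=.
by rewrite sigmaVK mulgV -deltaV deltaVK invgK mulgV.
Qed.

HB.instance Definition _ := isGroup.Build AS
  mp_circA mp_1circ mp_circ1 mp_Vcirc mp_circV.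

Fact mp_dotA : associative mp_dot.
Proof. by move=> u v w; rewrite /mp_dot /= !dotA. Qed.
Fact mp_circ_dot (u v w : AS) :
  u ∘ mp_dot v w = mp_dot (u ∘ v) (u ∘ mp_dot u^-1 w).
Proof.
case: u v w => [a x] [b y] [c w]; congr (_, _) => /=.
  by rewrite !sigma_dot circ_dot sigmaVK.
rewrite !delta_dot circ_dot; congr (_ ⋅ (_ ∘ (_ ⋅ _))).
by rewrite (deltaV a) invgK deltaVK.
Qed.

HB.instance Definition _ :=
  Group_isLeftSemiBrace.Build AS mp_dotA mp_circ_dot.

End MatchedProduct.

(* Main.v *)
Require Import Defs.
From HB Require Import structures.
From mathcomp Require Import all_boot.
From mathcomp Require Import boolp classical_sets.

(** The identity 1 of the circle group is a middle unit of (B, ⋅): putting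
    a = 1 in the brace identity gives b ⋅ 1 ⋅ c = b ⋅ c.  A completely simple
    semigroup with a middle unit is a rectangular group: 1 is idempotent,
    G = 1B1 is a group, and every b is e ⋅ g ⋅ r for a unique g in G, a unique
    idempotent e of K = B1 and a unique idempotent r of 1B.  Since
    1 ⋅ e = 1 = r ⋅ 1, the product of e ⋅ g ⋅ r and e' ⋅ g' ⋅ r' collapses to
    e ⋅ g ⋅ g' ⋅ r'; this is the Rees matrix isomorphism ([rees_iso]).  For the
    same reason (k, r) ↦ k ⋅ r is a multiplicative isomorphism from K × R to B,
    where R = E(1B) is a right zero semigroup.

    For the circle operation put λ_a(b) = a ∘ (a^-1 ⋅ b), so that
    a ∘ (b ⋅ c) = (a ∘ b) ⋅ λ_a(c).  The maps λ_a are multiplicative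
    endomorphisms, λ_(a ∘ b) = λ_a λ_b, and λ_1 is the multiplication by 1, the
    identity on 1B.  So each λ_a permutes R; on R it computes the circle
    operation, x ∘ y = λ_x(y), whence R is a sub-semi-brace
    ([R_sub_semibrace]).

    The hypothesis on ρ enters as λ_a(a^-1 ∘ b) = λ_a(a^-1) ⋅ b
    ([rho_antihom_lambda]).  With b = a in K it shows that λ_a(1) is an
    idempotent of the group G, so λ_a(1) = 1; this says that a^-1 lies in K,
    and K is a sub-semi-brace ([K_sub_semibrace]).

    Now K and R are subgroups of (B, ∘) with R ∩ K = {1} and
    k ⋅ r = k ∘ λ_(k^-1)(r), so B = K ∘ R is an exact factorization.  Writing
    x ∘ c = σ_x(c) ∘ δ_c(x) with x, δ_c(x) in R and c, σ_x(c) in K yields the two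
    actions; all the axioms of a matched pair that speak of the circle groups
    follow from uniqueness of the factorization, the one on products in R is
    trivial since R is right zero, and σ_x is multiplicative by
    [rho_antihom_lambda] once more ([dot1_circ_R]).  Finally an element that
    factors both as k ∘ r' and as r ∘ k' is k ⋅ r ([circ_exchange]), which
    identifies the circle operation of the matched product with that of B along
    (k, r) ↦ k ⋅ r ([matched_product_iso]). *)

Set Implicit Arguments.
Unset Strict Implicit.
Unset Printing Implicit Defensive.

Local Open Scope classical_set_scope.

(** * Completely simple semigroups with a middle unit *)

Section CompletelySimpleSemigroups.
Variables (T : Type) (op : T -> T -> T).
Hypothesis opA : associative op.
Local Notation "x * y" := (op x y).

Lemma simple_factor (a b : T) :
  simple_semigroup op -> exists x y, b = x * a * y.
Proof.
pose I : set T := [set z | exists x y, z = x * a * y].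
move=> /(_ I) Ifull; suff : I b by [].
rewrite Ifull //; split; first by exists (a * a * a), a, a.
move=> _ z [x [y ->]]; split; first by exists x, (y * z); rewrite !opA.
by exists (z * x), y; rewrite !opA.
Qed.

(** The local submonoid eTe is a group: simplicity gives x, y in eTe with
    x c y = e for c = e a e, and then c y x and y x c are idempotents of eTe,
    hence equal to e by primitivity. *)
Lemma primitive_local_inverse (e a : T) :
  simple_semigroup op -> primitive_idempotent op e ->
  exists b, [/\ e * b = b, b * e = b, e * a * e * b = e & b * (e * a * e) = e].
Proof.
move=> simT [ee e_min].
have [c cE] : exists c, c = e * a * e by exists (e * a * e).
have ec : e * c = c by rewrite cE !opA ee.
have ce : c * e = c by rewrite cE -!opA ee.
have [x [y [ex xe ey ye xcy]]] : exists x y,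
    [/\ e * x = x, x * e = x, e * y = y, y * e = y & x * c * y = e].
  have [x [y e_fac]] := simple_factor c e simT.
  exists (e * x * e), (e * y * e); split; rewrite ?opA ?ee // -?opA ?ee //.
  by rewrite (opA e c) ec (opA c e) ce (opA c) (opA x) (opA x) -e_fac !ee.
have cyx : c * (y * x) = e.
  apply: e_min; rewrite ?(opA e) ?ec -?opA ?xe //.
  by rewrite (opA x) (opA (x * c)) xcy ex.
have yxc : y * x * c = e.
  apply: e_min; rewrite ?opA ?ey // -?(opA _ c e) ?ce //.
  by rewrite -(opA y x) -(opA y (x * c)) xcy ye.
exists (y * x); split; rewrite -?cE ?(opA e) ?ey // -?opA ?xe //.
Qed.

Variable u : T.
Hypothesis u_mid : forall x y, x * u * y = x * y.
Hypothesis csT : completely_simple op.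

(** Factor u = p e q by simplicity.  As u is a middle unit, e u e = e, that is
    (e p e)(e q e) = e.  In the group eTe the two factors also commute, and
    u e u = p (e q e)(e p e) q. *)
Lemma middle_unit_primitive e : primitive_idempotent op e -> u * e * u = u.
Proof.
move=> e_prim; have [ee _] := e_prim; have simT := csT.1.
have [p [q u_fac]] := simple_factor e u simT.
have pq : e * p * e * (e * q * e) = e.
  rewrite !opA -(opA _ e e) ee -(opA e p) -(opA e (p * e)) -u_fac.
  by rewrite u_mid ee.
have [h [eh he ph hp]] := primitive_local_inverse p simT e_prim.
have qh : e * q * e = h.
  transitivity (e * (e * q * e)); first by rewrite !opA ee.
  by rewrite -[X in X * _]hp -opA pq he.
have qp : e * q * e * p * e = e by rewrite qh -he -2!opA (opA e) hp.
rewrite {1 2}u_fac !opA -(opA p e q) -(opA p _ e) -(opA p _ p) -(opA p _ e).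
by rewrite qp -u_fac.
Qed.

Lemma middle_unit_idem : u * u = u.
Proof.
have [_ [e e_prim]] := csT.
have ueu := middle_unit_primitive e_prim.
by rewrite -{1}ueu u_mid ueu.
Qed.

(** The map x ↦ e x e from uTu to the group eTe is inverted by x ↦ u x u,
    because e u e = e and u e u = u; so b is u h u where h is the inverse of
    e a e.  Regularity a b a = a comes from a = p e q, for which
    e a e = (e p e)(e q e) and therefore (e q e) h (e p e) = e. *)
Lemma middle_unit_inverse a :
  exists b, [/\ u * b = b, b * u = b, u * a * b = u, b * a * u = u
              & a * b * a = a].
Proof.
have [simT [e e_prim]] := csT; have [ee _] := e_prim.
have [h [eh he ah ha]] := primitive_local_inverse a simT e_prim.
have ueu := middle_unit_primitive e_prim.
have uu := middle_unit_idem.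
exists (u * h * u); split.
- by rewrite !opA uu.
- by rewrite -opA uu.
- rewrite !opA u_mid -{1}ueu -eh !opA u_mid -(opA u e a) -(opA u _ e).
  by rewrite -(opA u _ h) ah ueu.
- rewrite u_mid -{2}ueu -he !opA u_mid -(opA u h e) -(opA u _ a).
  by rewrite -(opA u _ e) -!opA (opA e a) (opA (e * a)) (opA h) ha opA ueu.
have [p [q a_fac]] := simple_factor e a simT.
have [l [_ _ _ lp]] := primitive_local_inverse p simT e_prim.
have [k [_ _ qk _]] := primitive_local_inverse q simT e_prim.
have pqE : e * p * e * (e * q * e) = e * a * e.
  by rewrite a_fac !opA -(opA _ e e) ee.
have : e * q * e * h * (e * p * e) = e.
  have : e * p * e * (e * q * e) * h * (e * p * e * (e * q * e))
      = e * p * e * (e * q * e) by rewrite pqE ah opA opA ee.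
  have : e * (e * q * e) = e * q * e by rewrite !opA ee.
  have : e * p * e * e = e * p * e by rewrite -opA ee.
  (* Cancel e p e on the left and e q e on the right by their inverses l, k. *)
  move: (e * p * e) (e * q * e) lp qk => p' q' lp qk pe eq.
  move/(congr1 (fun z => l * z * k)); rewrite !opA lp eq.
  by rewrite -(opA _ q' k) qk -(opA _ p' e) pe.
rewrite !opA -(opA _ e h) eh -(opA _ h e) he => qhp.
rewrite !u_mid {1 2}a_fac !opA.
by rewrite -!(opA p) qhp opA -a_fac.
Qed.

End CompletelySimpleSemigroups.

Local Open Scope group_scope.
Local Open Scope semibrace_scope.

(** * The lambda map of a left semi-brace *)

Section LambdaMap.
Variable B : leftSemiBraceType.
Implicit Types a b c : B.

Lemma dot1_mid b c : b ⋅ 1 ⋅ c = b ⋅ c.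
Proof. by have := circ_dot 1 b c; rewrite invg1 !mul1g -dotA => ->. Qed.

Definition lambda a b : B := a ∘ (a^-1 ⋅ b).

Lemma circ_dot_lambda a b c : a ∘ (b ⋅ c) = a ∘ b ⋅ lambda a c.
Proof. exact: circ_dot. Qed.

Lemma lambda_dot a : {morph lambda a : b c / b ⋅ c >-> b ⋅ c}.
Proof. by move=> b c; rewrite /lambda dotA circ_dot. Qed.

Lemma lambda_circ a b c : lambda (a ∘ b) c = lambda a (lambda b c).
Proof.
by rewrite {1}/lambda -mulgA invgM circ_dot_lambda mulgA mulgV mul1g.
Qed.

Lemma lambda_id c : lambda 1 c = 1 ⋅ c.
Proof. by rewrite /lambda invg1 mul1g. Qed.

Lemma lambdaK a c : lambda a (lambda a^-1 c) = 1 ⋅ c.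
Proof. by rewrite -lambda_circ mulgV lambda_id. Qed.

Lemma dot1_lambda a c : 1 ⋅ lambda a c = lambda a c.
Proof. by rewrite -lambda_id -lambda_circ mul1g. Qed.

Lemma lambda_dot1 a c : lambda a (1 ⋅ c) = lambda a c.
Proof. by rewrite -lambda_id -lambda_circ mulg1. Qed.

(** The usable content of the hypothesis on ρ.  Both sides come from evaluating
    ρ_(a^-1 ∘ b) = ρ_b ρ_(a^-1) at a, inverting, and cancelling b. *)
Lemma rho_antihom_lambda a b :
  rho_antihom B -> lambda a (a^-1 ∘ b) = lambda a a^-1 ⋅ b.
Proof.
move/(_ a^-1 b a); rewrite /rho /= mulgA => /mulIg.
by rewrite invgM !invgK => /(congr1 inv); rewrite invgM !invgK.
Qed.

End LambdaMap.

Lemma val_sub_circ (B : leftSemiBraceType) (P : set B) (HP : sub_semibrace P)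
  (x y : sub_semibrace_type HP) : val (x ∘ y) = val x ∘ val y.
Proof. by []. Qed.

Lemma val_sub_inv (B : leftSemiBraceType) (P : set B) (HP : sub_semibrace P)
  (x : sub_semibrace_type HP) : val x^-1 = (val x)^-1.
Proof. by []. Qed.

(** * The subgroups R = E(1B) and K = B1 of the circle group *)

Section CompletelySimpleSemiBrace.
Variable B : leftSemiBraceType.
Hypothesis Bcs : completely_simple_semibrace B.
Implicit Types a b c x y : B.
Local Notation R := (idempotents (one_dot B)).
Local Notation K := (dot_one B).

Lemma dot1_idem : 1 ⋅ 1 = 1 :> B.
Proof. exact: (middle_unit_idem (@dotA B) (@dot1_mid B) Bcs). Qed.

Lemma dot_inverse b : exists b',
  [/\ 1 ⋅ b' = b', b' ⋅ 1 = b', 1 ⋅ b ⋅ b' = 1, b' ⋅ b ⋅ 1 = 1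
    & b ⋅ b' ⋅ b = b].
Proof. exact: (middle_unit_inverse (@dotA B) (@dot1_mid B) Bcs). Qed.

Lemma dot_oneE x : K x <-> x ⋅ 1 = x.
Proof.
split=> [[b _ <-]|<-]; last by exists x.
by rewrite -dotA dot1_idem.
Qed.

Lemma one_dotE x : one_dot B x <-> 1 ⋅ x = x.
Proof.
split=> [[b _ <-]|<-]; last by exists x.
by rewrite dotA dot1_idem.
Qed.

(** Since 1B1 is a group, 1 is its only idempotent; and x ⋅ 1 = 1 ⋅ x ⋅ 1 is one
    by the middle unit law. *)
Lemma idem_dot1 x : 1 ⋅ x = x -> x ⋅ x = x -> x ⋅ 1 = 1.
Proof.
move=> x1 xx; have [y [_ _ xy _ _]] := dot_inverse x.
by rewrite x1 in xy; rewrite -xy dotA xx.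
Qed.

Lemma idem_1dot x : x ⋅ 1 = x -> x ⋅ x = x -> 1 ⋅ x = 1.
Proof.
move=> x1 xx; have [y [_ _ _ yx _]] := dot_inverse x.
by rewrite -dotA x1 in yx; rewrite -yx -dotA xx.
Qed.

Lemma idem_one_dotE x : R x <-> 1 ⋅ x = x /\ x ⋅ 1 = 1.
Proof.
split=> [[/one_dotE x1 xx]|[x1 x1']]; first by split=> //; exact: idem_dot1.
by split; [exact/one_dotE | rewrite -dot1_mid x1' x1].
Qed.

Lemma R_dotl x y : R x -> x ⋅ y = 1 ⋅ y.
Proof. by case/idem_one_dotE=> _ x1; rewrite -dot1_mid x1. Qed.

Lemma lambda_R a x : R x -> R (lambda a x).
Proof.
case=> _ xx; split; first by apply/one_dotE; rewrite dot1_lambda.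
by rewrite -lambda_dot xx.
Qed.

Lemma R_one : R 1.
Proof. by apply/idem_one_dotE; rewrite dot1_idem. Qed.

Lemma circ_R x y : R x -> x ∘ (1 ⋅ y) = lambda x y.
Proof.
by move=> Rx; rewrite circ_dot_lambda mulg1 R_dotl // dot1_lambda.
Qed.

Lemma lambda1_R x : R x -> lambda x 1 = x.
Proof. by move=> Rx; rewrite -circ_R // dot1_idem mulg1. Qed.

(** On R the circle operation is x ∘ y = λ_x(y), and λ_x permutes R; the inverse
    of x is the preimage of 1, namely λ_(x^-1)(1). *)
Lemma R_sub_semibrace : sub_semibrace R.
Proof.
have Rcirc x y : R x -> R y -> x ∘ y = lambda x y.
  by move=> Rx /idem_one_dotE[y1 _]; rewrite -{1}y1 circ_R.
split; first exact: R_one.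
- by move=> x y Rx Ry; rewrite Rcirc //; apply: lambda_R.
- move=> x Rx; have Ry := lambda_R x^-1 R_one.
  suff -> : x^-1 = lambda x^-1 1 by [].
  by apply: (mulgI x); rewrite [RHS]Rcirc // lambdaK dot1_idem mulgV.
- move=> x y Rx Ry; rewrite R_dotl //.
  by have [-> _] := (idem_one_dotE y).1 Ry.
Qed.

Lemma R_right_zero :
  right_zero_semibrace (sub_semibrace_type R_sub_semibrace).
Proof.
move=> x y; apply: val_inj => /=; rewrite R_dotl; last exact: set_valP.
by have [-> _] := (idem_one_dotE _).1 (set_valP y).
Qed.

Hypothesis Brho : rho_antihom B.

(** Taking b = a in [rho_antihom_lambda] gives λ_a(1) = λ_a(a^-1) ⋅ a, which lies
    in B1; but λ_a(1) also lies in R, and R meets B1 in 1 only. *)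
Lemma lambda1_K a : K a -> lambda a 1 = 1.
Proof.
move/dot_oneE => a1; have /idem_one_dotE[_ la1] := lambda_R a R_one.
have := rho_antihom_lambda a a Brho; rewrite mulVg => la.
by rewrite -[RHS]la1 la -dotA a1.
Qed.

Lemma K_sub_semibrace : sub_semibrace K.
Proof.
have dot_oneV a : K a -> K a^-1.
  (* The equality λ_a(1) = 1 is a ∘ (a^-1 ⋅ 1) = 1. *)
  move=> Ka; apply/dot_oneE/(mulgI a); rewrite mulgV.
  exact: lambda1_K Ka.
split=> //; first by apply/dot_oneE/dot1_idem.
  move=> a b Ka /dot_oneE b1; apply/dot_oneE.
  by rewrite -{2}b1 circ_dot_lambda lambda1_K.
by move=> a b Ka /dot_oneE b1; apply/dot_oneE; rewrite -dotA b1.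
Qed.

Lemma K_right_cancellative :
  right_cancellative_semibrace (sub_semibrace_type K_sub_semibrace).
Proof.
move=> z x y xz; apply: val_inj; have {xz} /= := congr1 val xz.
have [z' [_ _ zz' _ _]] := dot_inverse (val z).
move/(congr1 (dot^~ z')).
rewrite -[val x ⋅ _]dot1_mid -[val y ⋅ _]dot1_mid -!dotA !(dotA 1) zz'.
by rewrite !((dot_oneE _).1 (set_valP _)).
Qed.

(** * The exact factorization B = K ∘ R and its matched pair *)

Local Notation Rt := (sub_semibrace_type R_sub_semibrace).
Local Notation Kt := (sub_semibrace_type K_sub_semibrace).

Lemma circ_K_lambda1 x c : K c -> x ∘ c = x ∘ c ⋅ lambda x 1.
Proof. by move/dot_oneE=> c1; rewrite -{1}c1 circ_dot_lambda. Qed.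

Lemma dot_KR_dot1 a x : K a -> R x -> a ⋅ x ⋅ 1 = a.
Proof.
by move=> /dot_oneE a1 /idem_one_dotE[_ x1]; rewrite -dotA x1.
Qed.

(** Multiplication by 1 on the right recovers the K-component of the
    factorization K ∘ R, which makes that factorization unique. *)
Lemma circ_KR_dot1 a x : K a -> R x -> a ∘ x ⋅ 1 = a.
Proof.
move=> Ka Rx; have /idem_one_dotE[x1 _] := Rx.
rewrite -{1}x1 circ_dot_lambda mulg1; apply: dot_KR_dot1 => //.
exact: lambda_R.
Qed.

(** The link between the two operations: for a common value w of a ∘ x and
    y ∘ c one has w ⋅ 1 = a, and w = w ⋅ y because
    y ∘ (c ⋅ 1) = (y ∘ c) ⋅ λ_y(1). *)
Lemma circ_exchange a x y c :
  K a -> R x -> R y -> K c -> a ∘ x = y ∘ c -> a ∘ x = a ⋅ y.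
Proof.
move=> Ka Rx Ry Kc axyc; rewrite -[in RHS](circ_KR_dot1 Ka Rx) dot1_mid axyc.
by rewrite {1}circ_K_lambda1 // lambda1_R.
Qed.

(** [rho_antihom_lambda] at x^-1 reads λ_(x^-1)(x ∘ b) = 1 ⋅ b when x is
    idempotent; apply λ_x. *)
Lemma dot1_circ_R x b : R x -> 1 ⋅ (x ∘ b) = lambda x b.
Proof.
case=> _ xx; have := rho_antihom_lambda x^-1 b Brho.
rewrite invgK {2}/lambda invgK xx mulVg => /(congr1 (lambda x)).
by rewrite lambdaK lambda_dot1.
Qed.

(** With a = (x ∘ c) ⋅ 1, the element x ∘ c is a ⋅ x = a ∘ λ_(a^-1)(x).  Thus the
    cofactor of a lies in R, which is what allows to define δ. *)
Lemma exchange_lambda x c :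
  R x -> K c -> (x ∘ c ⋅ 1)^-1 ∘ (x ∘ c) = lambda (x ∘ c ⋅ 1)^-1 x.
Proof.
move=> Rx Kc; set a := x ∘ c ⋅ 1; have [x1 _] := (idem_one_dotE x).1 Rx.
apply: (mulgI a); rewrite mulVKg -[lambda _ _]dot1_lambda circ_dot_lambda mulg1.
by rewrite lambdaK x1 dot1_mid {1}circ_K_lambda1 // lambda1_R.
Qed.

Lemma sigma_KR_in (x : Rt) (a : Kt) : K (val x ∘ val a ⋅ 1).
Proof. by exists (val x ∘ val a). Qed.

Definition sigma_KR (x : Rt) (a : Kt) : Kt := SigSub (mem_set (sigma_KR_in x a)).

Lemma delta_KR_in (x : Rt) (a : Kt) :
  R ((val (sigma_KR x a))^-1 ∘ (val x ∘ val a)).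
Proof.
rewrite exchange_lambda; [exact/lambda_R/set_valP | |]; exact: set_valP.
Qed.

Definition delta_KR (a : Kt) (x : Rt) : Rt := SigSub (mem_set (delta_KR_in x a)).

Lemma exchange (x : Rt) (a : Kt) :
  val (sigma_KR x a) ∘ val (delta_KR a x) = val x ∘ val a.
Proof. exact: mulVKg. Qed.

Lemma exchange_uniq (x y : Rt) (a b : Kt) :
  val x ∘ val a = val b ∘ val y -> sigma_KR x a = b /\ delta_KR a x = y.
Proof.
rewrite -exchange => eq_xa.
have sE : sigma_KR x a = b.
  apply: val_inj; have := congr1 (dot^~ 1) eq_xa.
  by rewrite !circ_KR_dot1 //; apply: set_valP.
by split=> //; apply: val_inj; move: eq_xa; rewrite sE => /mulgI.
Qed.

Lemma exchange_circr (x : Rt) (a b : Kt) :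
  sigma_KR x (a ∘ b) = sigma_KR x a ∘ sigma_KR (delta_KR a x) b /\
  delta_KR (a ∘ b) x = delta_KR b (delta_KR a x).
Proof.
apply: exchange_uniq.
by rewrite !val_sub_circ -[RHS]mulgA exchange [RHS]mulgA exchange mulgA.
Qed.

Lemma exchange_circl (x y : Rt) (a : Kt) :
  sigma_KR (x ∘ y) a = sigma_KR x (sigma_KR y a) /\
  delta_KR a (x ∘ y) = delta_KR (sigma_KR y a) x ∘ delta_KR a y.
Proof.
apply: exchange_uniq.
by rewrite !val_sub_circ [RHS]mulgA exchange -[RHS]mulgA exchange mulgA.
Qed.

Lemma exchange1r (x : Rt) : sigma_KR x 1 = 1 /\ delta_KR 1 x = x.
Proof. by apply: exchange_uniq; rewrite /= mulg1 mul1g. Qed.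

Lemma exchange1l (a : Kt) : sigma_KR 1 a = a /\ delta_KR a 1 = 1.
Proof. by apply: exchange_uniq; rewrite /= mulg1 mul1g. Qed.

(** This axiom concerns the semigroup K, so uniqueness of the factorization does
    not give it: x ∘ (a ⋅ b) = (x ∘ a) ⋅ λ_x(b), and λ_x(b) = 1 ⋅ (x ∘ b). *)
Lemma sigma_KR_dot (x : Rt) :
  {morph sigma_KR x : a b / a ⋅ b >-> a ⋅ b}.
Proof.
move=> a b; apply: val_inj => /=.
rewrite circ_dot_lambda -dot1_circ_R ?dotA //; exact: set_valP.
Qed.

Lemma delta_KR_bij (a : Kt) : bijective (delta_KR a).
Proof.
exists (delta_KR a^-1) => x; rewrite -(exchange_circr _ _ _).2.
  by rewrite mulgV; case: (exchange1r x).
by rewrite mulVg; case: (exchange1r x).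
Qed.

Lemma sigma_KR_bij (x : Rt) : bijective (sigma_KR x).
Proof.
exists (sigma_KR x^-1) => a; rewrite -(exchange_circl _ _ _).1.
  by rewrite mulVg; case: (exchange1l a).
by rewrite mulgV; case: (exchange1l a).
Qed.

Definition exchange_matched_pair : matched_pair Kt Rt.
Proof.
apply: (@MatchedPair _ _ delta_KR sigma_KR).
- exact: delta_KR_bij.
- by move=> a b x; rewrite (exchange_circr _ _ _).2.
- exact: sigma_KR_bij.
- exact: sigma_KR_dot.
- by move=> x y a; rewrite (exchange_circl _ _ _).1.
- by move=> x a b; rewrite (exchange_circr _ _ _).1.
- by move=> x; case: (exchange1r x).
- by move=> a x y; rewrite (exchange_circl _ _ _).2.
- by move=> a; case: (exchange1l a).
by move=> a x y; rewrite !R_right_zero.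
Defined.

Lemma circ_exchange_KR (a c : Kt) (x y : Rt) :
  val a ∘ val x = val y ∘ val c -> val a ∘ val x = val a ⋅ val y.
Proof. by apply: circ_exchange; apply: set_valP. Qed.

(** The exchange equation for x^-1 and a, solved for the remaining two sides:
    the same element written in K ∘ R and in R ∘ K. *)
Lemma exchangeV (x : Rt) (a : Kt) :
  val a ∘ val (delta_KR a x^-1)^-1 = val x ∘ val (sigma_KR x^-1 a).
Proof.
apply: (mulIg (val (delta_KR a x^-1))); rewrite val_sub_inv mulgVK.
by rewrite -mulgA exchange val_sub_inv mulVKg.
Qed.

Lemma dot_exchange (x : Rt) (a : Kt) :
  val a ⋅ val x = val a ∘ val (delta_KR a x^-1)^-1 /\
  val a ⋅ val x = val x ∘ val (sigma_KR x^-1 a).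
Proof.
have e := exchangeV x a.
by rewrite -(circ_exchange_KR e).
Qed.

Lemma R_mid b x c : R x -> b ⋅ x ⋅ c = b ⋅ c.
Proof. by move=> Rx; rewrite -dotA (R_dotl _ Rx) dotA dot1_mid. Qed.

(** The isomorphism sends (a, x) to a ⋅ x.  For the circle operation, write
    a ⋅ x = a ∘ z = x ∘ c and b ⋅ y = b ∘ t = y ∘ d by [dot_exchange].  Exchanging
    z and b puts the product in the form p ∘ r, exchanging c and y in the form
    (x ∘ w) ∘ k, where (p, x ∘ w) is the circle product of (a, x) and (b, y) in
    the matched product; so [circ_exchange] applies. *)
Lemma matched_product_iso :
  semibrace_isomorphic B (matched_product exchange_matched_pair).
Proof.
pose g (u : matched_product exchange_matched_pair) : B := val u.1 ⋅ val u.2.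
have g_inj : injective g.
  move=> [a x] [b y]; rewrite /g /= => gE.
  have ab : a = b.
    apply: val_inj; have := congr1 (dot^~ 1) gE.
    by rewrite !dot_KR_dot1 //; apply: set_valP.
  rewrite ab in gE *; congr (_, _); apply: val_inj.
  have [b' [_ _ _ b'b _]] := dot_inverse (val b).
  have := congr1 (dot b') gE; rewrite -(dot1_mid _ (val x)) -(dot1_mid _ (val y)) !dotA b'b.
  by rewrite !(proj1 ((idem_one_dotE _).1 (set_valP _))).
have g_surj b : exists u, g u = b.
  have [b' [b'1 b1' _ b'b bb'b]] := dot_inverse b.
  have Kb : K (b ⋅ 1) by exists b.
  have Rb : R (b' ⋅ b) by apply/idem_one_dotE; rewrite dotA b'1.
  exists (SigSub (mem_set Kb), SigSub (mem_set Rb)).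
  by rewrite /g /= dot1_mid dotA.
have [f fK] := choice g_surj.
have gK : cancel g f by move=> u; apply: g_inj; rewrite fK.
have g_dot : {morph g : u v / u ⋅ v >-> u ⋅ v}.
  move=> [a x] [b y]; rewrite /g /= !dotA.
  by rewrite !(R_mid _ _ (set_valP x)).
have g_circ : {morph g : u v / u ∘ v >-> u ∘ v}.
  move=> [a x] [b y]; rewrite /g /=.
  set z := (delta_KR a x^-1)^-1; set c := sigma_KR x^-1 a.
  set w := (delta_KR c^-1 y^-1)^-1; pose t := (delta_KR b y^-1)^-1.
  pose p := a ∘ sigma_KR z b; pose r := delta_KR b z ∘ t.
  pose k := (sigma_KR y^-1 c^-1)^-1 ∘ sigma_KR y^-1 b.
  have wE : val c ∘ val y = val w ∘ val (sigma_KR y^-1 c^-1)^-1.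
    by apply: invg_inj; rewrite /w !invgM !val_sub_inv !invgK exchange.
  have axby_pr : val a ⋅ val x ∘ (val b ⋅ val y) = val p ∘ val r.
    rewrite (dot_exchange x a).1 (dot_exchange y b).1 /p /r !val_sub_circ.
    by rewrite -mulgA (mulgA (val z)) -exchange -(mulgA _ _ (val t)) mulgA.
  have axby_xwk :
      val a ⋅ val x ∘ (val b ⋅ val y) = val (x ∘ w) ∘ val k.
    rewrite (dot_exchange x a).2 (dot_exchange y b).2 /k !val_sub_circ.
    by rewrite -mulgA (mulgA (val c)) wE -!mulgA.
  have prxw : val p ∘ val r = val (x ∘ w) ∘ val k by rewrite -axby_pr.
  by rewrite axby_pr (circ_exchange_KR prxw).
exists f; split; first by exists g.
  by move=> b c; apply: (can_inj gK); rewrite g_dot !fK.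
by move=> b c; apply: g_inj; rewrite g_circ !fK.
Qed.
End CompletelySimpleSemiBrace.

(** * The Rees matrix decomposition *)

Lemma idempotents_idem (B : leftSemiBraceType) (P : set B) :
  idempotents (idempotents P) = idempotents P.
Proof. by apply/seteqP; split=> [x []|x [Px xx]]. Qed.

(** With v b the inverse of 1 ⋅ b ⋅ 1 in 1B1, the coordinates of b are
    1 ⋅ b ⋅ 1, the idempotent b ⋅ v b of B1 and the idempotent v b ⋅ b of 1B; the
    inverse map multiplies the three coordinates, and it is a morphism because
    the inner idempotents j, k of i ⋅ g ⋅ j ⋅ k ⋅ h ⋅ l both act as
    middle units there. *)
Lemma rees_iso (B : leftSemiBraceType) :
  completely_simple_semibrace B ->
  exists G : dot_group (one_dot_one B),
    semigroup_isomorphic (@dot B) (rees_mul (dot_group_type G)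
      (idempotents (dot_one B)) (idempotents (one_dot B))).
Proof.
move=> Bcs; have /choice[v vP] := dot_inverse Bcs.
have one1 := dot1_idem Bcs.
have oneE (b : B) : one_dot_one B b <-> 1 ⋅ b = b /\ b ⋅ 1 = b.
  split=> [[c _ <-]|[b1 b1']]; first by rewrite -(dotA _ 1 1) one1 !dotA one1.
  by exists b; rewrite // b1.
have G : dot_group (one_dot_one B).
  exists 1 v.
  - move=> x y /oneE[x1 _] /oneE[_ y1]; apply/oneE.
    by rewrite dotA x1 -dotA y1.
  - exact/oneE.
  - by move=> x _; apply/oneE; case: (vP x).
  - by move=> x /oneE[].
  - by move=> x /oneE[].
  - by move=> x /oneE[x1 x1']; case: (vP x) => _ _ _; rewrite -dotA x1'.
  by move=> x /oneE[x1 x1']; case: (vP x) => _ _; rewrite x1.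
exists G.
have Rin b : idempotents (one_dot B) (v b ⋅ b).
  have [v1 v1' _ vb bvb] := vP b.
  by apply/(idem_one_dotE Bcs); rewrite dotA v1.
have Kin b : idempotents (dot_one B) (b ⋅ v b).
  have [v1 v1' bv vb bvb] := vP b.
  split; first by apply/(dot_oneE Bcs); rewrite -dotA v1'.
  by rewrite dotA bvb.
have Gin b : one_dot_one B (1 ⋅ b ⋅ 1) by exists b.
pose mk b : dot_group_type G * idempotents (dot_one B) * idempotents (one_dot B)
  := (SigSub (mem_set (Gin b)), SigSub (mem_set (Kin b)),
      SigSub (mem_set (Rin b))).
pose prod3 (s : dot_group_type G * idempotents (dot_one B)
    * idempotents (one_dot B)) := val s.1.2 ⋅ val s.1.1 ⋅ val s.2.
have mkK : cancel mk prod3.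
  move=> b; have [_ _ _ _ bvb] := vP b.
  by rewrite /prod3 /= !dotA !dot1_mid !bvb.
have prod3K : cancel prod3 mk.
  move=> [[g i] j]; have [g1 g1'] := (oneE _).1 (set_valP g).
  have [Ki ii] := set_valP i; have i1 := (dot_oneE Bcs _).1 Ki.
  have i1' := idem_1dot Bcs i1 ii.
  have [j1 j1'] := (idem_one_dotE Bcs _).1 (set_valP j).
  have [_ _ xv vx _] := vP (prod3 (g, i, j)).
  congr (_, _, _); apply: val_inj => /=.
  - by rewrite /prod3 /= !dotA i1' g1 -dotA j1' g1'.
  - move: (v _) xv => h; rewrite /prod3 /= !dotA i1' g1 => gjh.
    by rewrite -(dotA (val i)) -(dotA (val i)) gjh.
  move: (v _) vx => h; rewrite /prod3 /= !dotA -(dotA _ (val j)) j1'.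
  by rewrite -(dotA _ (val g)) g1' => ->.
exists mk; split; first by exists prod3.
move=> b c; apply: (can_inj prod3K); rewrite mkK.
rewrite -{1}(mkK b) -{1}(mkK c); case: (mk b) (mk c) => [[g i] j] [[h k] l].
have [Kk kk] := set_valP k; have k1 := (dot_oneE Bcs _).1 Kk.
rewrite /prod3 /= !dotA (R_mid Bcs _ _ (set_valP j)).
rewrite -(dot1_mid _ (val k)) -(dotA _ 1) (idem_1dot Bcs k1 kk).
by rewrite dot1_mid.
Qed.

Theorem theorem3p2 (B : leftSemiBraceType)
    (Bcs : completely_simple_semibrace B) (Brho : rho_antihom B) :
  let R := idempotents (one_dot B) in
  let K := dot_one B in
  exists (HR : sub_semibrace R) (HK : sub_semibrace K),
    [/\ right_zero_semibrace (sub_semibrace_type HR),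
        right_cancellative_semibrace (sub_semibrace_type HK),
        exists M : matched_pair (sub_semibrace_type HK) (sub_semibrace_type HR),
          semibrace_isomorphic B (matched_product M)
      & exists G : dot_group (one_dot_one B),
          semigroup_isomorphic (@dot B)
            (rees_mul (dot_group_type G) (idempotents K) (idempotents R))].
Proof.
exists (R_sub_semibrace Bcs), (K_sub_semibrace Bcs Brho); split.
- exact: R_right_zero.
- exact: K_right_cancellative.
- by exists (exchange_matched_pair Bcs Brho); exact: matched_product_iso.
by rewrite idempotents_idem; exact: rees_iso.
Qed.
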